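(* Let $0<r<1$, $y=\frac{\sqrt3}{6}$ and $k=6+2\left\lceil \frac1r-1\right\rceil$. Then $k$ agents of transmission range $r$ starting at the centroid of an equilateral triangle with sides of length $1$ can be evacuated in worst-case time $1+2y\approx 1.5773$, and this is optimal; that is, there is an evacuation algorithm for $k$ agents with worst-case evacuation time $1+2y$, and no evacuation algorithm for $k$ agents has smaller worst-case evacuation time.
   Context: A single exit lies at a point of the perimeter of the triangle, unknown to the agents. All agents start at the centroid at time $0$ and can move at speed at most $1$. An agent recognizes the exit only when it is at the exit's location. Two agents at distance at most $r$ can exchange information instantly, and agents can act as relays, so information passes instantly between any two agents joined by a chain of agents with consecutive distances at most $r$. An algorithm (deterministic) assigns each agent a predetermined trajectory, which the agent may leave only after it has found the exit or has been notified of the exit's location, and specifies its actions in those cases. The evacuation time for a given exit location is the first time by which all agents have reached the exit; the worst-case evacuation time is the supremum over all exit locations on the perimeter. *)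

(* Defs.v *)
From HB Require Import structures.
From mathcomp Require Import all_boot all_order all_algebra.
From mathcomp Require Import all_classical all_reals all_analysis.

Set Implicit Arguments.
Unset Strict Implicit.
Unset Printing Implicit Defensive.

Import Order.TTheory GRing.Theory Num.Theory.
Local Open Scope classical_set_scope.
Local Open Scope ring_scope.

Section Geometry.
Variable R : realType.
Implicit Types A B C p q : 'rV[R]_2.

(* The library norm on 'rV[R]_2 is the sup norm, hence this definition. *)
Definition eucl_dist p q : R :=
  Num.sqrt (\sum_(i < 2) (p 0 i - q 0 i) ^+ 2).

Definition segment p q : set 'rV[R]_2 :=
  [set (1 - l) *: p + l *: q | l in [set l : R | 0 <= l <= 1]].

Definition perimeter A B C : set 'rV[R]_2 :=
  segment A B `|` segment B C `|` segment C A.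

Definition centroid A B C : 'rV[R]_2 := 3^-1 *: (A + B + C).

End Geometry.

Section Evacuation.
Variables (R : realType) (k : nat) (r : R).

(* [informed e pos i t]: when the exit is at [e] and the agents move according
   to [pos], agent [i] knows the location of the exit at time [t].  Relaying is
   instantaneous because [informed_msg] can be iterated at a fixed time. *)
Inductive informed (e : 'rV[R]_2) (pos : 'I_k -> R -> 'rV[R]_2) :
    'I_k -> R -> Prop :=
| informed_find i t : 0 <= t -> pos i t = e -> informed e pos i t
| informed_keep i s t : informed e pos i s -> s <= t -> informed e pos i t
| informed_msg i j t : informed e pos j t ->
    eucl_dist (pos i t) (pos j t) <= r -> informed e pos i t.

Definition unit_speed (f : R -> 'rV[R]_2) : Prop :=
  forall s t : R, 0 <= s -> s <= t -> eucl_dist (f s) (f t) <= t - s.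

(* [traj i] is the predetermined trajectory of agent [i].  The actions of an
   agent that knows the exit are recorded through the resulting motion:
   [run e i] is the whole motion of agent [i] when the exit is at [e].  As the
   system is deterministic and [e] is its only unknown, everything an informed
   agent may base its actions on (including when and how it was informed) is a
   function of [e], so no further argument is needed; an uninformed agent, by
   [run_uninformed], cannot depend on [e].  Since motions are continuous and
   [informed] is a least fixed point, this constraint is causal. *)
Record algorithm (start : 'rV[R]_2) (exits : set 'rV[R]_2) := Algorithm {
  traj : 'I_k -> R -> 'rV[R]_2;
  run : 'rV[R]_2 -> 'I_k -> R -> 'rV[R]_2;
  traj_start : forall i, traj i 0 = start;
  traj_speed : forall i, unit_speed (traj i);
  run_start : forall e i, exits e -> run e i 0 = start;
  run_speed : forall e i, exits e -> unit_speed (run e i);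
  run_uninformed : forall e i t, exits e -> 0 <= t ->
    ~ informed e (run e) i t -> run e i t = traj i t
}.

(* Equal to [+oo] when some agent never reaches the exit. *)
Definition evacuation_time start exits (alg : algorithm start exits)
    (e : 'rV[R]_2) : \bar R :=
  ereal_inf [set t%:E | t in [set t : R | 0 <= t /\
    forall i, exists2 s, 0 <= s <= t & run alg e i s = e]].

Definition worst_case_time start exits (alg : algorithm start exits) :
    \bar R :=
  ereal_sup [set evacuation_time alg e | e in exits].

End Evacuation.

(* Main.v *)
(* Lower bound: let p be the first of two given vertices to be visited when no
   exit is found, at time t >= 2y, and put the exit at the other vertex q.  The
   visitor of p still follows its trajectory at time t, so it needs time t + 1
   to reach q.

   Upper bound: let m = ceil(1/r - 1) and h = 1/(m + 1) <= r.  At time 2y, two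
   explorers are at each vertex, and m relays are evenly spaced on each of the
   sides AB and AC.  The explorers then leave the vertices along both sides and
   meet at the midpoints.  When they have moved by d, everybody is in the hexagon
   spanned by the six explorers, whose vertices are at distance at most 1 - d
   from all its points; so if one of them finds the exit, all agents can reach
   it by time (2y + d) + (1 - d).  It remains to keep the agents connected.  As
   the two explorers of a corner move apart, a relay reached by an explorer takes
   over the exploration while the explorer starts moving parallel to the other
   side of the corner: the agents left behind in this way are spaced by h on the
   segment between the two explorers of that corner.  With this exchange of
   roles, the agents form a path with steps at most h in barycentric
   coordinates. *)

Require Import Defs.
From HB Require Import structures.
From mathcomp Require Import all_boot all_order all_algebra.
From mathcomp Require Import all_classical all_reals all_analysis.
From mathcomp Require Import ring lra zify.

Set Implicit Arguments.
Unset Strict Implicit.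
Unset Printing Implicit Defensive.

Import Order.TTheory GRing.Theory Num.Theory.
Local Open Scope classical_set_scope.
Local Open Scope ring_scope.

(** * Euclidean distance and unit-speed motions in the plane *)

Section EuclideanPlane.
Variable R : realType.
Implicit Types (p q s : 'rV[R]_2) (f : R -> 'rV[R]_2).

Lemma eucl_distE p q : eucl_dist p q =
  Num.sqrt ((p 0 0 - q 0 0) ^+ 2 + (p 0 1 - q 0 1) ^+ 2).
Proof.
rewrite /eucl_dist big_ord_recl big_ord1.
by congr (Num.sqrt (_ + (p 0 _ - q 0 _) ^+ 2)); apply/val_inj.
Qed.

Lemma eucl_dist_ge0 p q : 0 <= eucl_dist p q.
Proof. exact: sqrtr_ge0. Qed.

Lemma eucl_distC p q : eucl_dist p q = eucl_dist q p.
Proof. by rewrite !eucl_distE; congr Num.sqrt; ring. Qed.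

Lemma eucl_dist_eq0 p q : eucl_dist p q <= 0 -> p = q.
Proof.
rewrite eucl_distE => d0.
have s0 : 0 <= (p 0 0 - q 0 0) ^+ 2 + (p 0 1 - q 0 1) ^+ 2.
  by rewrite addr_ge0 ?sqr_ge0.
have /eqP : Num.sqrt ((p 0 0 - q 0 0) ^+ 2 + (p 0 1 - q 0 1) ^+ 2) = 0.
  by apply/eqP; rewrite eq_le d0 sqrtr_ge0.
rewrite sqrtr_eq0 => s1.
have /eqP : (p 0 0 - q 0 0) ^+ 2 + (p 0 1 - q 0 1) ^+ 2 = 0.
  by apply/eqP; rewrite eq_le s1 s0.
rewrite paddr_eq0 ?sqr_ge0// !sqrf_eq0 !subr_eq0 => /andP[/eqP e0 /eqP e1].
apply/rowP => i; case: i => [[|[|//]] ilt].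
- by rewrite (_ : Ordinal ilt = 0) //; apply/val_inj.
- by rewrite (_ : Ordinal ilt = 1) //; apply/val_inj.
Qed.

Lemma eucl_dist_triangle p s q :
  eucl_dist p q <= eucl_dist p s + eucl_dist s q.
Proof.
rewrite !eucl_distE.
have -> : p 0 0 - q 0 0 = (p 0 0 - s 0 0) + (s 0 0 - q 0 0) by ring.
have -> : p 0 1 - q 0 1 = (p 0 1 - s 0 1) + (s 0 1 - q 0 1) by ring.
move: (p 0 0 - s 0 0) (s 0 0 - q 0 0) (p 0 1 - s 0 1) (s 0 1 - q 0 1).
move=> a b c d.
have P (x z : R) : 0 <= x ^+ 2 + z ^+ 2 by rewrite addr_ge0 ?sqr_ge0.
have := sqr_sqrtr (P a c); have := sqr_sqrtr (P b d).
have := sqrtr_ge0 (a ^+ 2 + c ^+ 2); have := sqrtr_ge0 (b ^+ 2 + d ^+ 2).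
move: (Num.sqrt (a ^+ 2 + c ^+ 2)) (Num.sqrt (b ^+ 2 + d ^+ 2)).
move=> u v v0 u0 vE uE.
have cs : a * b + c * d <= u * v.
  apply: le_trans (ler_norm _) _.
  rewrite -(@ler_pXn2r _ 2%N) ?nnegrE ?normr_ge0 ?mulr_ge0//.
  rewrite real_normK ?num_real// exprMn uE vE -subr_ge0.
  (* Lagrange's identity, which yields Cauchy-Schwarz. *)
  rewrite (_ : _ - _ = (a * d - b * c) ^+ 2) ?sqr_ge0//; ring.
rewrite -(@ger0_norm _ (u + v)) ?addr_ge0// -sqrtr_sqr ler_wsqrtr//.
nra.
Qed.

Lemma eucl_dist_line p q (l l' : R) :
  eucl_dist (p + l *: (q - p)) (p + l' *: (q - p)) = `|l - l'| * eucl_dist p q.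
Proof.
rewrite !eucl_distE !mxE -sqrtr_sqr -sqrtrM ?sqr_ge0//.
by congr Num.sqrt; ring.
Qed.

(** The cap at 1 keeps the walker at [q] after [t0 + d]; before [t0] the formula extrapolates. *)
Definition walk p q (t0 d t : R) : 'rV[R]_2 :=
  p + Num.min 1 ((t - t0) / d) *: (q - p).

Lemma walk_start p q (t0 d : R) : walk p q t0 d t0 = p.
Proof. by rewrite /walk subrr mul0r minEle ler10 scale0r addr0. Qed.

Lemma walk_end p q (t0 d : R) : 0 < d -> walk p q t0 d (t0 + d) = q.
Proof.
move=> d0; rewrite /walk [t0 + d]addrC addrK divff ?gt_eqF// minxx scale1r.
by rewrite addrC subrK.
Qed.

Lemma walk_speed p q (t0 d s t : R) : 0 < d -> eucl_dist p q <= d -> s <= t ->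
  eucl_dist (walk p q t0 d s) (walk p q t0 d t) <= t - s.
Proof.
move=> d0 pq st; rewrite eucl_dist_line.
have H : `|Num.min 1 ((s - t0) / d) - Num.min 1 ((t - t0) / d)| <= (t - s) / d.
  have -> : (t - t0) / d = (s - t0) / d + (t - s) / d by field; lra.
  have : 0 <= (t - s) / d by rewrite divr_ge0//; lra.
  move: ((s - t0) / d) ((t - s) / d) => x z z0.
  rewrite ler_norml; apply/andP; split;
    case: (leP 1 x) => ?; case: (leP 1 (x + z)) => ?; lra.
apply: le_trans (_ : (t - s) / d * d <= _); last by rewrite divfK// gt_eqF.
by apply: ler_pM => //; exact: eucl_dist_ge0.
Qed.

Definition splice (t0 : R) f g (t : R) := if t <= t0 then f t else g t.

Lemma splice_speed (t0 : R) f g : f t0 = g t0 ->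
  (forall s t : R, 0 <= s -> s <= t -> t <= t0 -> eucl_dist (f s) (f t) <= t - s) ->
  (forall s t : R, t0 <= s -> s <= t -> eucl_dist (g s) (g t) <= t - s) ->
  unit_speed (splice t0 f g).
Proof.
move=> fg fs gs s t s0 st; rewrite /splice.
case: (leP s t0) => st0; case: (leP t t0) => tt0.
- exact: fs.
- apply: le_trans (eucl_dist_triangle _ (f t0) _) _.
  have -> : t - s = (t0 - s) + (t - t0) by ring.
  by apply: lerD; [exact: fs|rewrite fg; apply: gs => //; exact: ltW].
- lra.
- by apply: gs => //; exact: ltW.
Qed.

End EuclideanPlane.

(** * Spread of information, the lower bound, and a criterion for upper bounds *)

Section Search.
Variables (R : realType) (k : nat) (r : R).
Implicit Types (e : 'rV[R]_2) (pos : 'I_k -> R -> 'rV[R]_2).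

Lemma informed_found e pos i t : informed r e pos i t ->
  exists j s, [/\ 0 <= s, s <= t & pos j s = e].
Proof.
elim=> {i t} [i t t0 <-|i s t _ [j [u [u0 us <-]]] st|i j t _ H _] //.
- by exists i, t.
- by exists j, u; split=> //; apply: le_trans us st.
Qed.

Lemma informed_chain e pos t :
  (forall i j : 'I_k, j = i.+1 :> nat ->
     eucl_dist (pos i t) (pos j t) <= r) ->
  forall i j, informed r e pos i t -> informed r e pos j t.
Proof.
move=> chain.
(* An equivalence, since messages travel along the chain both ways. *)
have H n : forall i j : 'I_k, j = (i + n)%N :> nat ->
    informed r e pos i t <-> informed r e pos j t.
  elim: n => [|n IH] i j; rewrite ?addn0 ?addnS => ij.
    by rewrite (_ : j = i) //; exact: val_inj.
  have lt : (i + n < k)%N by rewrite ltnW// -ij.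
  rewrite (IH i (Ordinal lt))//.
  have d := chain (Ordinal lt) j ij.
  by split=> H; apply: informed_msg H _; rewrite // eucl_distC.
move=> i j; case: (leqP i j) => ij.
  by apply: (H (j - i)%N i j _).1; rewrite subnKC.
by apply: (H (i - j)%N j i _).2; rewrite subnKC// ltnW.
Qed.

(** The infimum of the visiting times is attained: if even the agent nearest to [e] at that time
    were at a positive distance, the speed bound would exclude visits shortly after. *)
Lemma first_visit e pos : (forall i, unit_speed (pos i)) ->
  (exists i t, 0 <= t /\ pos i t = e) ->
  exists i t, [/\ 0 <= t, pos i t = e &
    forall j s, 0 <= s -> pos j s = e -> t <= s].
Proof.
move=> speed [i0 [t [t0 te]]].
pose S := [set s : R | 0 <= s /\ exists i, pos i s = e].
have infS : has_inf S.
  by split; [exists t; split => //; exists i0|exists 0 => s []].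
have inf_le s : S s -> inf S <= s by move=> Ss; apply: ge_inf => //; case: infS.
have inf0 : 0 <= inf S by apply: lb_le_inf; [case: infS|move=> s []].
have [i hi] : exists i, pos i (inf S) = e.
  pose i1 := [arg min_(i < i0) eucl_dist (pos i (inf S)) e]%O.
  have i1P j : eucl_dist (pos i1 (inf S)) e <= eucl_dist (pos j (inf S)) e.
    by rewrite /i1; case: arg_minP => // i _ /(_ j); apply.
  exists i1; apply: eucl_dist_eq0; rewrite leNgt; apply/negP => d0.
  have [s [s0 [j sj]] sd] := inf_adherent d0 infS.
  have := inf_le s (conj s0 (ex_intro _ j sj)) => ls.
  have := speed j _ _ inf0 ls; rewrite sj => h.
  have := i1P j; lra.
exists i, (inf S); split=> // j s s0 js; apply: inf_le; split=> //.
by exists j.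
Qed.

Variables (start : 'rV[R]_2) (exits : set 'rV[R]_2).

(* Nothing is learnt before the exit is first visited, so up to that moment
   (included, by continuity) the agents are on their predetermined
   trajectories. *)
Lemma run_before_visit (alg : algorithm k r start exits) e : exits e ->
  (exists i t, 0 <= t /\ run alg e i t = e) ->
  exists i t, [/\ 0 <= t, traj alg i t = e,
    (forall j s, 0 <= s <= t -> run alg e j s = traj alg j s) &
    (forall j s, 0 <= s -> run alg e j s = e -> t <= s)].
Proof.
move=> ee vis.
have [i [t [t0 te tmin]]] := first_visit (fun i => run_speed alg i ee) vis.
have before j s : 0 <= s -> s < t -> run alg e j s = traj alg j s.
  move=> s0 st; apply: run_uninformed => // /informed_found[i' [u [u0 us ue]]].
  have := tmin _ _ u0 ue; lra.
have at_t j : run alg e j t = traj alg j t.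
  have [t_eq0|t_neq0] := eqVneq t 0.
    by rewrite t_eq0 run_start// traj_start.
  have t_gt0 : 0 < t by rewrite lt_def t_neq0.
  apply: eucl_dist_eq0; rewrite leNgt; apply/negP => d0.
  set d := eucl_dist _ _ in d0.
  (* Run and trajectory agree at [s] and each moves by at most [d / 4] until [t], so they cannot be
     [d] apart there. *)
  pose s := Num.max 0 (t - d / 4).
  have s0 : 0 <= s by rewrite le_max lexx.
  have st : s < t by rewrite gt_max; apply/andP; split; lra.
  have ds : t - s <= d / 4.
    have : t - d / 4 <= s by rewrite le_max lexx orbT.
    lra.
  have h1 := run_speed alg j ee s0 (ltW st).
  have h2 := traj_speed alg j s0 (ltW st).
  rewrite before// in h1.
  have := eucl_dist_triangle (run alg e j t) (traj alg j s) (traj alg j t).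
  rewrite -/d (eucl_distC (run alg e j t)); lra.
exists i, t; split=> //; first by rewrite -at_t.
move=> j s /andP[s0]; rewrite le_eqVlt => /orP[/eqP ->//|]; exact: before.
Qed.

Lemma evacuation_time_lt (alg : algorithm k r start exits) e (T : R) :
  (evacuation_time alg e < T%:E)%E ->
  exists t : R, t < T /\ forall i, exists2 s, 0 <= s <= t & run alg e i s = e.
Proof.
move=> /ereal_inf_lt[_ [t [t0 all_e] <-]]; rewrite lte_fin => tT.
by exists t.
Qed.

Lemma worst_case_time_ge (alg : algorithm k r start exits) p q (d : R) :
  (0 < k)%N -> exits p -> exits q ->
  d <= eucl_dist start p -> d <= eucl_dist start q ->
  ((eucl_dist p q + d)%:E <= worst_case_time alg)%E.
Proof.
move=> k0 ep eq dp dq; rewrite leNgt; apply/negP => lt.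
have small e : exits e -> exists t : R, t < eucl_dist p q + d /\
    forall i, exists2 s, 0 <= s <= t & run alg e i s = e.
  move=> ee; apply: evacuation_time_lt; apply: le_lt_trans lt.
  by apply: ereal_sup_ubound; exists e.
have visits e : exits e -> exists i t, 0 <= t /\ run alg e i t = e.
  move=> ee; have [t [_ /(_ (Ordinal k0))[s /andP[s0 _] se]]] := small e ee.
  by exists (Ordinal k0), s.
(* With the exit at [b], agent [i] still follows its trajectory at [ta], so it is at [a], not before
   time [d], and has yet to go from [a] to [b]. *)
have arg a b tb : exits a -> exits b -> eucl_dist a b = eucl_dist p q ->
    d <= eucl_dist start a ->
    (forall j s, 0 <= s <= tb -> run alg b j s = traj alg j s) ->
    (forall j s, 0 <= s -> run alg b j s = b -> tb <= s) ->
    forall i ta, 0 <= ta -> traj alg i ta = a -> ta <= tb -> False.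
  move=> ea eb ab da b_before b_first i ta ta0 tra tatb.
  have [t [tlt /(_ i)[s /andP[s0 st] se]]] := small b eb.
  have tbs := b_first i s s0 se.
  have h1 := run_speed alg i eb ta0 (le_trans tatb tbs).
  rewrite se b_before ?ta0// tra ab in h1.
  have h2 := traj_speed alg i (lexx 0) ta0.
  rewrite traj_start tra subr0 in h2; lra.
have [i [tp [tp0 trp p_before p_first]]] := run_before_visit ep (visits p ep).
have [j [tq [tq0 trq q_before q_first]]] := run_before_visit eq (visits q eq).
case: (leP tp tq) => h.
  exact: (arg p q tq ep eq erefl dp q_before q_first i tp).
apply: (arg q p tp eq ep _ dq p_before p_first j tq) => //.
  exact: eucl_distC.
exact: ltW.
Qed.

(** [T e] is some visit of the exit, perhaps not the first: agents informed earlier keep to [tr]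
    until [T e], when the chain informs everyone; then all walk straight to [e], due at time [D]. *)
Lemma evacuation_of_schedule (tr : 'I_k -> R -> 'rV[R]_2)
    (T : 'rV[R]_2 -> R) (D : R) :
  (forall i, tr i 0 = start) -> (forall i, unit_speed (tr i)) ->
  (forall e, exits e -> 0 <= T e < D) ->
  (forall e, exits e -> exists i, tr i (T e) = e) ->
  (forall e (i j : 'I_k), exits e -> j = i.+1 :> nat ->
     eucl_dist (tr i (T e)) (tr j (T e)) <= r) ->
  (forall e i, exits e -> eucl_dist (tr i (T e)) e <= D - T e) ->
  exists alg : algorithm k r start exits, (worst_case_time alg <= D%:E)%E.
Proof.
move=> tr0 trs TD Tfind Tchain Tdist.
pose rn e i := splice (T e) (tr i) (walk (tr i (T e)) e (T e) (D - T e)).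
have rn_tr e i t : t <= T e -> rn e i t = tr i t by rewrite /rn /splice => ->.
have rn0 e i : exits e -> rn e i 0 = start.
  by move=> /TD/andP[? _]; rewrite rn_tr.
have rns e i : exits e -> unit_speed (rn e i).
  move=> ee; have /andP[T0 TltD] := TD e ee.
  apply: splice_speed; first by rewrite walk_start.
    by move=> s t s0 st _; exact: trs.
  by move=> s t _ st; apply: walk_speed => //; [lra|exact: Tdist].
have inf_all e i t : exits e -> T e <= t -> informed r e (rn e) i t.
  move=> ee Tt; apply: informed_keep Tt; have [j je] := Tfind e ee.
  apply: (@informed_chain _ _ _ _ j).
    by move=> i1 i2 i12; rewrite !rn_tr//; exact: Tchain.
  by apply: informed_find; [have /andP[] := TD e ee|rewrite rn_tr].
have rnu e i t : exits e -> 0 <= t ->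
    ~ informed r e (rn e) i t -> rn e i t = tr i t.
  move=> ee t0 un; apply: rn_tr; rewrite leNgt; apply/negP => /ltW Tt.
  exact/un/inf_all.
exists (Algorithm tr0 trs rn0 rns rnu).
apply: ge_ereal_sup => _ [e ee <-]; apply: ereal_inf_lbound.
have /andP[T0 TltD] := TD e ee.
exists D => //; split=> [|i]; first lra.
exists D; first by apply/andP; split; lra.
rewrite /= /rn /splice leNgt TltD /=.
have {2}-> : D = T e + (D - T e) by ring.
by rewrite walk_end//; lra.
Qed.

End Search.

(** * Motion of one agent along one edge *)

Section Leg.
Variable R : realType.
Implicit Types h a d : R.

(* An agent starts on an edge [PQ] of length 1, at distance [a] from [P], and the
   explorers, having left the vertices, have moved by [d].  It waits for the
   explorer coming from [P], then explores in its place along a length [h1],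
   after which the next agent takes over and it drifts parallel to the other
   side at [P]; symmetrically at [Q] with [h2].  Its barycentric coordinates are
   [leg_near h1 a d] at [Q], [leg_near h2 (1 - a) d] at [P] and
   [leg_off h1 h2 a d] at the third vertex.  The values [a = - h1] and
   [a = 1 + h2] give the explorers of the other sides at [P] and [Q]. *)
Definition leg_near h a d := Num.min (Num.min (Num.max d a) (a + h)) (1 - d).
Definition leg_off (h1 h2 : R) a d :=
  Num.max (Num.max 0 (d - a - h1)) (d - (1 - a) - h2).

(* Innermost operators first, so that the recorded inequalities are linear. *)
Ltac minmax_free t := lazymatch t with
  | context [Order.max _ _] => fail
  | context [Order.min _ _] => fail
  | _ => idtac
  end.
Ltac minmax := rewrite /leg_near /leg_off;
  repeat match goal with
  | |- context [Order.max ?x ?y] =>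
      minmax_free x; minmax_free y; case: (leP x y) => ?
  | |- context [Order.min ?x ?y] =>
      minmax_free x; minmax_free y; case: (leP x y) => ?
  end; lra.

Lemma leg_off_sym (h1 h2 : R) a d :
  leg_off h1 h2 a d = leg_off h2 h1 (1 - a) d.
Proof. by rewrite /leg_off subKr maxAC. Qed.

Lemma leg_sum (h1 h2 : R) a d : 0 <= h1 -> 0 <= h2 -> - h1 <= a <= 1 + h2 ->
  0 <= d <= 2^-1 ->
  leg_near h1 a d + leg_near h2 (1 - a) d + leg_off h1 h2 a d = 1.
Proof.
wlog a_half : h1 h2 a / a <= 2^-1 => [sym|] h10 h20 /andP[a0 a1] d01.
  case: (leP a 2^-1) => a_half; first by apply: sym => //; apply/andP.
  rewrite leg_off_sym [leg_near h1 _ _ + _]addrC.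
  rewrite -{2}(subKr 1 a); apply: sym => //; try apply/andP; lra.
have /andP[d0 d1] := d01.
(* As [a] and [d] are at most 1/2, the explorer from [Q] has not passed the agent, so [h2] drops
   out. *)
have -> : leg_near h2 (1 - a) d = 1 - Num.max d a by minmax.
have -> : leg_off h1 h2 a d = Num.max 0 (d - a - h1).
  by rewrite /leg_off; apply: max_idPl; rewrite le_max; apply/orP; left; lra.
minmax.
Qed.

Lemma leg_near_range h a d : - h <= a -> 0 <= d <= 2^-1 ->
  0 <= leg_near h a d <= 1 - d.
Proof. by move=> ha /andP[d0 d1]; apply/andP; split; minmax. Qed.

Lemma leg_off_range (h1 h2 : R) a d : - h1 <= a <= 1 + h2 -> 0 <= d <= 2^-1 ->
  0 <= leg_off h1 h2 a d <= 1 - d.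
Proof. by move=> /andP[a0 a1] /andP[d0 d1]; apply/andP; split; minmax. Qed.

Lemma leg_near_lip h a d d' : d <= d' ->
  `|leg_near h a d - leg_near h a d'| <= d' - d.
Proof. by move=> dd; rewrite ler_norml; apply/andP; split; minmax. Qed.

Lemma leg_off_lip (h1 h2 : R) a d d' : d <= d' ->
  `|leg_off h1 h2 a d - leg_off h1 h2 a d'| <= d' - d.
Proof. by move=> dd; rewrite ler_norml; apply/andP; split; minmax. Qed.

Lemma leg_near_step h a a' d : a <= a' ->
  0 <= leg_near h a' d - leg_near h a d <= a' - a.
Proof. by move=> aa; apply/andP; split; minmax. Qed.

Lemma leg_near_front h a d : a <= d <= a + h -> 0 <= d <= 2^-1 ->
  leg_near h a d = d.
Proof. by move=> /andP[? ?] /andP[? ?]; minmax. Qed.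

Lemma leg_near_far h a d : 1 - d <= a -> 0 <= h -> 0 <= d <= 2^-1 ->
  leg_near h a d = 1 - d.
Proof. by move=> ? ? /andP[? ?]; minmax. Qed.

Lemma leg_near0 h d : 0 <= d <= 2^-1 -> leg_near h (- h) d = 0.
Proof. by move=> /andP[? ?]; minmax. Qed.

End Leg.

(** * Barycentric coordinates in the unit equilateral triangle *)

Section Barycentric.
Variables (R : realType) (A B C : 'rV[R]_2).
Hypotheses (AB1 : eucl_dist A B = 1) (BC1 : eucl_dist B C = 1)
           (CA1 : eucl_dist C A = 1).

Definition bary (a b c : R) : 'rV[R]_2 := a *: A + b *: B + c *: C.

Lemma eucl_dist_bary a b c a' b' c' : a + b + c = 1 -> a' + b' + c' = 1 ->
  eucl_dist (bary a b c) (bary a' b' c') =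
  Num.sqrt (((a - a') ^+ 2 + (b - b') ^+ 2 + (c - c') ^+ 2) / 2).
Proof.
move=> s s'.
have sq p q : eucl_dist p q = 1 ->
    (p 0 0 - q 0 0) ^+ 2 + (p 0 1 - q 0 1) ^+ 2 = 1 :> R.
  rewrite eucl_distE => pq; rewrite -[LHS]sqr_sqrtr ?pq ?expr1n//.
  by rewrite addr_ge0 ?sqr_ge0.
have := sq _ _ AB1; have := sq _ _ BC1; have := sq _ _ CA1.
rewrite eucl_distE !mxE.
move: (A 0 0) (A 0 1) (B 0 0) (B 0 1) (C 0 0) (C 0 1) => x x' z z' w w' h1 h2 h3.
congr Num.sqrt.
have -> : a = 1 - b - c by rewrite -s; ring.
have -> : a' = 1 - b' - c' by rewrite -s'; ring.
(* Squared norm of a combination of [B - A] and [C - A], with their inner product expressed by the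
   law of cosines. *)
transitivity ((b - b') ^+ 2 * ((x - z) ^+ 2 + (x' - z') ^+ 2)
  + (c - c') ^+ 2 * ((w - x) ^+ 2 + (w' - x') ^+ 2)
  + (b - b') * (c - c') * (((x - z) ^+ 2 + (x' - z') ^+ 2)
  + ((w - x) ^+ 2 + (w' - x') ^+ 2) - ((z - w) ^+ 2 + (z' - w') ^+ 2))).
  ring.
by rewrite h1 h2 h3; field.
Qed.

(* The unit ball of the maximum of the (signed) barycentric coordinates, on
   vectors, is the regular hexagon inscribed in the unit disk. *)
Lemma eucl_dist_bary_le (d a b c a' b' c' : R) :
  a + b + c = 1 -> a' + b' + c' = 1 ->
  `|a - a'| <= d -> `|b - b'| <= d -> `|c - c'| <= d ->
  eucl_dist (bary a b c) (bary a' b' c') <= d.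
Proof.
move=> s s' ha hb hc; rewrite eucl_dist_bary//.
have d0 : 0 <= d := le_trans (normr_ge0 _) ha.
rewrite -(ger0_norm d0) -sqrtr_sqr ler_wsqrtr//.
move: ha hb hc; have -> : c - c' = - (a - a') - (b - b') by lra.
move: (a - a') (b - b') => u v; rewrite !ler_norml.
move=> /andP[? ?] /andP[? ?] /andP[? ?].
by case: (leP 0 u) => ?; case: (leP 0 v) => ?; nra.
Qed.

Lemma bary_A : bary 1 0 0 = A.
Proof. by rewrite /bary scale1r !scale0r !addr0. Qed.

Lemma bary_B : bary 0 1 0 = B.
Proof. by rewrite /bary scale1r !scale0r addr0 add0r. Qed.

Lemma centroid_bary : centroid A B C = bary 3^-1 3^-1 3^-1.
Proof. by rewrite /centroid /bary !scalerDr. Qed.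

(** [2 * y] is the circumradius, of square 1/3. *)
Lemma centroid_vertex y : y = Num.sqrt 3 / 6 ->
  2 * y <= eucl_dist (centroid A B C) A /\ 2 * y <= eucl_dist (centroid A B C) B.
Proof.
move=> ->; have y3 : 0 <= 2 * (Num.sqrt 3 / 6 : R).
  by rewrite mulr_ge0// divr_ge0// sqrtr_ge0.
rewrite -(ger0_norm y3) -sqrtr_sqr !exprMn sqr_sqrtr//.
rewrite centroid_bary -[in X in X /\ _]bary_A -[in X in _ /\ X]bary_B.
rewrite !eucl_dist_bary; try field; split; rewrite ler_wsqrtr//; lra.
Qed.

(** The squared distance is half of [a^2 + b^2 + c^2 - 1/3], and the squares sum to at most
    [(a + b + c)^2 = 1]. *)
Lemma centroid_dist_le y a b c : y = Num.sqrt 3 / 6 ->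
  a + b + c = 1 -> 0 <= a -> 0 <= b -> 0 <= c ->
  eucl_dist (centroid A B C) (bary a b c) <= 2 * y.
Proof.
move=> -> s a0 b0 c0; have y3 : 0 <= 2 * (Num.sqrt 3 / 6 : R).
  by rewrite mulr_ge0// divr_ge0// sqrtr_ge0.
rewrite -(ger0_norm y3) -sqrtr_sqr !exprMn sqr_sqrtr//.
rewrite centroid_bary eucl_dist_bary//; last by field.
rewrite ler_wsqrtr//.
have -> : c = 1 - a - b by lra.
nra.
Qed.

End Barycentric.

(** * The path formed by the [2 * m + 6] agents *)

Section Chain.
Variables (R : realType) (m : nat).

Definition gap : R := m.+1%:R^-1.

Lemma gapE : m%:R * gap + gap = 1 :> R.
Proof. by rewrite /gap -[X in _ + X]mul1r -mulrDl natr1 divff. Qed.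

Lemma gap_gt0 : 0 < gap.
Proof. by rewrite invr_gt0 ltr0n. Qed.

(* Agents [0 .. m + 3] are on the leg from [B] to [A], the following ones, in
   reverse order, on the leg from [C] to [A].  Both legs have [m] relays; the
   first one moreover contains the explorers of [BC] near [B] (agent [0]) and
   of [AC] near [A] (agent [m + 3]), the second one that of [BC] near [C]
   (agent [2 * m + 5]).  On the leg from [C] to [A] the relays reached by the
   explorer coming from [A] just move with it ([h2 = 1]). *)
Definition leg_BA (i : nat) : bool := (i < m + 4)%N.
Definition offset (i : nat) : R :=
  if leg_BA i then i%:R * gap - gap else 2 + 2 * gap - i%:R * gap.
Definition coordA i d := leg_near gap (offset i) d.
Definition coordB i d := if leg_BA i then leg_near gap (1 - offset i) d
  else leg_off gap 1 (offset i) d.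
Definition coordC i d := if leg_BA i then leg_off gap gap (offset i) d
  else leg_near 1 (1 - offset i) d.

Lemma offset_range i : (i < 2 * m + 6)%N ->
  if leg_BA i then - gap <= offset i <= 1 + gap
  else - gap <= offset i <= 1 - gap.
Proof.
rewrite /offset /leg_BA => ik; have g0 := gap_gt0; have gE := gapE.
case: ltnP => im.
  have : i%:R * gap <= (m + 3)%:R * gap.
    by rewrite ler_wpM2r ?(ltW g0)// ler_nat; lia.
  have : 0 <= i%:R * gap by rewrite mulr_ge0// ltW.
  rewrite natrD mulrDl => ? ?; apply/andP; split; lra.
have : i%:R * gap <= (2 * m + 5)%:R * gap.
  by rewrite ler_wpM2r ?(ltW g0)// ler_nat; lia.
have : (m + 4)%:R * gap <= i%:R * gap.
  by rewrite ler_wpM2r ?(ltW g0)// ler_nat; lia.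
have -> : (2 * m + 5)%:R = 2 * m%:R + 5 :> R by rewrite natrD natrM.
rewrite natrD !mulrDl -mulrA => ? ?; apply/andP; split; lra.
Qed.

Lemma coord_sum i d : (i < 2 * m + 6)%N -> 0 <= d <= 2^-1 ->
  coordA i d + coordB i d + coordC i d = 1.
Proof.
move=> /offset_range; rewrite /coordA /coordB /coordC.
have g0 := gap_gt0; case: ifP => _ /andP[l0 l1] d01.
  by rewrite leg_sum//; (lra || (apply/andP; split; lra)).
by rewrite addrAC leg_sum//; (lra || (apply/andP; split; lra)).
Qed.

Lemma coord_range i d : (i < 2 * m + 6)%N -> 0 <= d <= 2^-1 ->
  [/\ 0 <= coordA i d <= 1 - d, 0 <= coordB i d <= 1 - d &
      0 <= coordC i d <= 1 - d].
Proof.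
move=> /offset_range; rewrite /coordA /coordB /coordC.
have g0 := gap_gt0; case: ifP => _ /andP[l0 l1] d01.
  by split; (apply: leg_near_range || apply: leg_off_range) => //;
    (lra || (apply/andP; split; lra)).
by split; (apply: leg_near_range || apply: leg_off_range) => //;
  (lra || (apply/andP; split; lra)).
Qed.

Lemma coord_lip i d d' : d <= d' ->
  [/\ `|coordA i d - coordA i d'| <= d' - d,
      `|coordB i d - coordB i d'| <= d' - d &
      `|coordC i d - coordC i d'| <= d' - d].
Proof.
by rewrite /coordA /coordB /coordC => dd; case: ifP => _; split;
  (apply: leg_near_lip || apply: leg_off_lip).
Qed.

Lemma coord_A_explorer d : 0 <= d <= 2^-1 ->
  [/\ coordA (m + 3) d = 1 - d, coordB (m + 3) d = 0 & coordC (m + 3) d = d].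
Proof.
move=> d01; have g0 := gap_gt0; have gE := gapE.
have mk : (m + 3 < 2 * m + 6)%N by lia.
have /andP[d0 d1] := d01.
have oE : offset (m + 3) = 1 + gap.
  by rewrite /offset /leg_BA ltn_add2l /= natrD mulrDl; lra.
have a1 : coordA (m + 3) d = 1 - d.
  by rewrite /coordA oE leg_near_far//; lra.
have b0 : coordB (m + 3) d = 0.
  by rewrite /coordB /leg_BA ltn_add2l /= oE opprD addrA subrr sub0r leg_near0.
by split=> //; have := coord_sum mk d01; lra.
Qed.

(** Along a leg two coordinates change by at most [gap] in opposite directions; as the sum is
    constant, the third changes by at most [gap] too. *)
Lemma coord_step i d : (i.+1 < 2 * m + 6)%N -> 0 <= d <= 2^-1 ->
  [/\ `|coordA i d - coordA i.+1 d| <= gap,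
      `|coordB i d - coordB i.+1 d| <= gap &
      `|coordC i d - coordC i.+1 d| <= gap].
Proof.
move=> ik d01; have g0 := gap_gt0; have gE := gapE.
have sum := coord_sum (ltnW ik) d01; have sum' := coord_sum ik d01.
have iS : i.+1%:R * gap = i%:R * gap + gap by rewrite -natr1 mulrDl mul1r.
have [lt|ge] := ltnP i.+1 (m + 4).
  have oS : offset i.+1 = offset i + gap.
    by rewrite /offset /leg_BA lt (ltnW lt) iS; lra.
  have hA : 0 <= coordA i.+1 d - coordA i d <= gap.
    rewrite /coordA oS.
    have := @leg_near_step _ gap (offset i) (offset i + gap) d.
    move=> /(_ ltac:(lra)) /andP[? ?]; apply/andP; split; lra.
  have hB : 0 <= coordB i d - coordB i.+1 d <= gap.
    rewrite /coordB /leg_BA lt (ltnW lt) oS.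
    have := @leg_near_step _ gap (1 - (offset i + gap)) (1 - offset i) d.
    move=> /(_ ltac:(lra)) /andP[? ?]; apply/andP; split; lra.
  move: hA hB => /andP[? ?] /andP[? ?].
  by split; rewrite ler_norml; apply/andP; split; lra.
have [/eqP iE|iN] := boolP (i == m + 3)%N.
  subst i; have [-> -> ->] := coord_A_explorer d01.
  have oE : offset (m + 3).+1 = 1 - gap.
    by rewrite /offset /leg_BA iS -addnS ltnn natrD mulrDl; lra.
  (* The explorer [m + 3] is also where offset 1 on the second leg would put an agent, because
     [h2 = 1] there; agent [m + 4] is one [gap] before. *)
  have := @leg_near_step _ gap (1 - gap) 1 d ltac:(lra).
  rewrite (@leg_near_far _ gap 1)//; try lra.
  have := @leg_near_step _ 1 0 gap d (ltW g0).
  rewrite (@leg_near_front _ 1 0) ?add0r//; last by apply/andP; split; lra.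
  have eA : coordA (m + 3).+1 d = leg_near gap (1 - gap) d by rewrite /coordA oE.
  have eC : coordC (m + 3).+1 d = leg_near 1 gap d.
    by rewrite /coordC oE /leg_BA -addnS ltnn subKr.
  rewrite -eA -eC => /andP[? ?] /andP[? ?].
  by split; rewrite ler_norml; apply/andP; split; lra.
have gt : (i < m + 4)%N = false by lia.
have gt' : (i.+1 < m + 4)%N = false by lia.
have oS : offset i.+1 = offset i - gap.
  by rewrite /offset /leg_BA gt gt' iS; lra.
have := @leg_near_step _ gap (offset i - gap) (offset i) d ltac:(lra).
have := @leg_near_step _ 1 (1 - offset i) (1 - (offset i - gap)) d ltac:(lra).
rewrite -oS -[leg_near gap _ _]/(coordA i d) -[leg_near gap _ _]/(coordA i.+1 d).
have -> : leg_near 1 (1 - offset i) d = coordC i d by rewrite /coordC /leg_BA gt.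
have -> : leg_near 1 (1 - offset i.+1) d = coordC i.+1 d.
  by rewrite /coordC /leg_BA gt'.
rewrite oS => /andP[? ?] /andP[? ?].
by split; rewrite ler_norml; apply/andP; split; lra.
Qed.

End Chain.

(** * The evacuation schedule *)

Section Schedule.
Variables (R : realType) (m : nat) (A B C : 'rV[R]_2).
Hypotheses (AB1 : eucl_dist A B = 1) (BC1 : eucl_dist B C = 1)
           (CA1 : eucl_dist C A = 1).

Definition place (i : nat) (d : R) : 'rV[R]_2 :=
  bary A B C (coordA m i d) (coordB m i d) (coordC m i d).

Lemma place_lip i d d' : (i < 2 * m + 6)%N -> 0 <= d -> d <= d' ->
  d' <= 2^-1 -> eucl_dist (place i d) (place i d') <= d' - d.
Proof.
move=> ik d0 dd d1; have [? ? ?] := coord_lip m i dd.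
by apply: eucl_dist_bary_le => //; apply: coord_sum => //;
  apply/andP; split=> //; [exact: le_trans dd d1|exact: le_trans d0 dd].
Qed.

Lemma place_step i d : (i.+1 < 2 * m + 6)%N -> 0 <= d <= 2^-1 ->
  eucl_dist (place i d) (place i.+1 d) <= gap R m.
Proof.
move=> ik d01; have [? ? ?] := coord_step ik d01.
by apply: eucl_dist_bary_le => //; apply: coord_sum => //; exact: ltnW.
Qed.

(* At [d], all agents are in the hexagon cut out by the explorers, where every
   barycentric coordinate is between [0] and [1 - d]. *)
Lemma place_dist i j d : (i < 2 * m + 6)%N -> (j < 2 * m + 6)%N ->
  0 <= d <= 2^-1 -> eucl_dist (place i d) (place j d) <= 1 - d.
Proof.
move=> ik jk d01.
have [/andP[? ?] /andP[? ?] /andP[? ?]] := coord_range ik d01.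
have [/andP[? ?] /andP[? ?] /andP[? ?]] := coord_range jk d01.
apply: eucl_dist_bary_le; rewrite ?coord_sum//.
all: by rewrite ler_norml; apply/andP; split; lra.
Qed.

(** [n] counts the handovers made once the explorers have moved by [d]. *)
Lemma gap_cell (d : R) : 0 <= d <= 2^-1 ->
  exists2 n, (n <= m)%N & n%:R * gap R m <= d <= n%:R * gap R m + gap R m.
Proof.
move=> /andP[d0 d1]; have g0 := gap_gt0 R m; have gE := gapE R m.
have dg0 : 0 <= d / gap R m by rewrite divr_ge0// ltW.
have /andP[lo hi] := truncn_itv dg0.
exists (Num.truncn (d / gap R m)); last first.
  move: lo hi; rewrite ler_pdivlMr// ltr_pdivrMr// -natr1 mulrDl mul1r.
  by move=> -> /ltW ->.
rewrite -ltnS -(ltr_nat R); apply: le_lt_trans lo _.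
by rewrite ltr_pdivrMr// -natr1 mulrDl mul1r; lra.
Qed.

(** Each explorer covers half a side. Those leaving [A] and [B] along [AB] and [C] along [CA] start
    as agents [m + 2], [1] and [2 * m + 4], and after [n] handovers are [m + 2 - n], [n + 1] and
    [2 * m + 4 - n]. The other three stay agents [0], [m + 3] and [2 * m + 5]. *)
Lemma place_explored e : perimeter A B C e ->
  exists2 d, 0 <= d <= 2^-1 & exists2 i, (i < 2 * m + 6)%N & place i d = e.
Proof.
have g0 := gap_gt0 R m; have gE := gapE R m.
have off i : (i <= m + 3)%N -> offset R m i = i%:R * gap R m - gap R m.
  by move=> im; rewrite /offset /leg_BA; case: ltnP => //; lia.
have off' i : (m + 4 <= i)%N ->
    offset R m i = 2 + 2 * gap R m - i%:R * gap R m.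
  by move=> im; rewrite /offset /leg_BA; case: ltnP => //; lia.
have sumE i d a b c : (i < 2 * m + 6)%N -> 0 <= d <= 2^-1 ->
    a + b + c = 1 ->
    [\/ coordA m i d = a /\ coordB m i d = b,
        coordA m i d = a /\ coordC m i d = c |
        coordB m i d = b /\ coordC m i d = c] ->
    place i d = bary A B C a b c.
  move=> ik d01 s H; have := coord_sum ik d01; rewrite /place.
  move=> s'; suff [-> -> ->] : [/\ coordA m i d = a, coordB m i d = b &
    coordC m i d = c] by [].
  by case: H => [[? ?]|[? ?]|[? ?]]; split; lra.
have segE (l : R) : 0 <= l <= 1 ->
    0 <= l <= 2^-1 \/ 0 <= 1 - l <= 2^-1.
  move=> /andP[l0 l1]; case: (leP l 2^-1) => ?; [left|right];
    apply/andP; split; lra.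
move=> [[|]|] [l /= /segE[] l01 <-].
- have -> : (1 - l) *: A + l *: B = bary A B C (1 - l) l 0.
    by rewrite /bary scale0r addr0.
  have /andP[l0 l1] := l01.
  exists l => //; have [n nm /andP[n0 n1]] := gap_cell l01.
  have im : (m + 2 - n <= m + 3)%N by lia.
  exists (m + 2 - n)%N; first lia.
  have oE : offset R m (m + 2 - n) = 1 - n%:R * gap R m.
    by rewrite off// natrB ?natrD ?mulrBl ?mulrDl; [lra|lia].
  apply: sumE => //; [lia|ring|constructor 1].
  rewrite /coordA /coordB /leg_BA oE subKr; have -> : (m + 2 - n < m + 4)%N by lia.
  by rewrite leg_near_far ?leg_near_front//; (lra || (apply/andP; split; lra)).
- set u := 1 - l in l01 *; have -> : l = 1 - u by rewrite /u subKr.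
  have -> : u *: A + (1 - u) *: B = bary A B C u (1 - u) 0.
    by rewrite /bary scale0r addr0.
  have /andP[u0 u1] := l01.
  exists u => //; have [n nm /andP[n0 n1]] := gap_cell l01.
  exists n.+1; first lia.
  have oE : offset R m n.+1 = n%:R * gap R m.
    by rewrite off; [rewrite -natr1 mulrDl mul1r addrK|lia].
  apply: sumE => //; [lia|ring|constructor 1].
  rewrite /coordA /coordB /leg_BA oE; have -> : (n.+1 < m + 4)%N by lia.
  by rewrite leg_near_front ?leg_near_far//; (lra || (apply/andP; split; lra)).
- have -> : (1 - l) *: B + l *: C = bary A B C 0 (1 - l) l.
    by rewrite /bary scale0r add0r.
  have /andP[l0 l1] := l01.
  exists l => //; exists 0%N; first lia.
  have oE : offset R m 0 = - gap R m by rewrite off// mul0r sub0r.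
  apply: sumE => //; [lia|ring|constructor 1].
  rewrite /coordA /coordB /leg_BA oE addn4 /=.
  by rewrite leg_near0// leg_near_far//; (lra || (apply/andP; split; lra)).
- set u := 1 - l in l01 *; have -> : l = 1 - u by rewrite /u subKr.
  have -> : u *: B + (1 - u) *: C = bary A B C 0 u (1 - u).
    by rewrite /bary scale0r add0r.
  have /andP[u0 u1] := l01.
  exists u => //; exists (2 * m + 5)%N; first lia.
  have oE : offset R m (2 * m + 5) = - gap R m.
    rewrite off'; last lia.
    have -> : (2 * m + 5)%:R = 2 * m%:R + 5 :> R by rewrite natrD natrM.
    lra.
  apply: sumE => //; [lia|ring|constructor 2].
  rewrite /coordA /coordC /leg_BA oE.
  have -> : (2 * m + 5 < m + 4)%N = false by lia.
  by rewrite leg_near0// leg_near_far//; (lra || (apply/andP; split; lra)).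
- have -> : (1 - l) *: C + l *: A = bary A B C l 0 (1 - l).
    by rewrite /bary scale0r addr0 addrC.
  have /andP[l0 l1] := l01.
  exists l => //; have [n nm /andP[n0 n1]] := gap_cell l01.
  exists (2 * m + 4 - n)%N; first lia.
  have oE : offset R m (2 * m + 4 - n) = n%:R * gap R m.
    rewrite off'; last lia.
    have -> : (2 * m + 4 - n)%:R = 2 * m%:R + 4 - n%:R :> R.
      by rewrite natrB; [rewrite natrD natrM|lia].
    lra.
  apply: sumE => //; [lia|ring|constructor 2].
  rewrite /coordA /coordC /leg_BA oE.
  have -> : (2 * m + 4 - n < m + 4)%N = false by lia.
  by rewrite leg_near_front ?leg_near_far//; (lra || (apply/andP; split; lra)).
- set u := 1 - l in l01 *; have -> : l = 1 - u by rewrite /u subKr.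
  have -> : u *: C + (1 - u) *: A = bary A B C (1 - u) 0 u.
    by rewrite /bary scale0r addr0 addrC.
  exists u => //; exists (m + 3)%N; first lia.
  by rewrite /place; have [-> -> ->] := coord_A_explorer m l01.
Qed.

Lemma triangle_evacuation (r y : R) : y = Num.sqrt 3 / 6 -> gap R m <= r ->
  exists alg : algorithm (2 * m + 6) r (centroid A B C) (perimeter A B C),
    (worst_case_time alg <= (1 + 2 * y)%:E)%E.
Proof.
move=> yE gr.
have y0 : 0 < 2 * y by rewrite yE mulr_gt0// divr_gt0// sqrtr_gt0.
pose explored e := [set d : R | 0 <= d <= 2^-1 /\
  exists2 i, (i < 2 * m + 6)%N & place i d = e].
(* The default 0 is never taken for [e] on the perimeter. *)
pose dt e := xget 0 (explored e).
have dtP e : perimeter A B C e -> explored e (dt e).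
  move=> /place_explored[d d01 [i ik ie]].
  by apply: (@xgetPex _ 0 (explored e)); exists d; split=> //; exists i.
(* The schedule is frozen once the explorers have met, at [d = 1/2]. *)
pose tr (i : 'I_(2 * m + 6)) := splice (2 * y)
  (walk (centroid A B C) (place i 0) 0 (2 * y))
  (fun t => place i (Num.min (t - 2 * y) 2^-1)).
have trE i (d : R) : 0 <= d <= 2^-1 -> tr i (2 * y + d) = place i d.
  move=> /andP[d0 d1]; rewrite /tr /splice; case: leP => h.
    have -> : d = 0 by lra.
    by rewrite addr0 -{2}[2 * y]add0r walk_end.
  by rewrite [2 * y + d]addrC addrK min_l.
have half0 : 0 <= (0 : R) <= 2^-1 by apply/andP; split; lra.
apply: (@evacuation_of_schedule _ _ _ _ _ tr (fun e => 2 * y + dt e)).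
- by move=> i; rewrite /tr /splice ltW// walk_start.
- move=> i; apply: splice_speed.
  + by rewrite -{2}[2 * y]add0r walk_end// subrr min_l//; lra.
  + move=> s t s0 st _; apply: walk_speed => //.
    have [/andP[? ?] /andP[? ?] /andP[? ?]] := coord_range (ltn_ord i) half0.
    by apply: centroid_dist_le => //; exact: coord_sum.
  + move=> s t ys st.
    apply: le_trans (place_lip (ltn_ord i) _ _ _) _.
    * by rewrite le_min; apply/andP; split; lra.
    * by rewrite le_min !ge_min; apply/andP; split; apply/orP;
        [left|right]; lra.
    * by rewrite ge_min lexx orbT.
    * by case: (leP (s - 2 * y) 2^-1) => ?; case: (leP (t - 2 * y) 2^-1) => ?;
        lra.
- by move=> e /dtP[/andP[? ?] _]; apply/andP; split; lra.
- move=> e /dtP[d01 [i ik ie]]; exists (Ordinal ik).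
  by rewrite trE.
- move=> e i j /dtP[d01 _] ij; rewrite !trE//; apply: le_trans gr.
  by rewrite ij; apply: place_step; rewrite // -ij.
- move=> e i /dtP[d01 [j jk je]]; rewrite trE// -{2}je.
  have -> : 1 + 2 * y - (2 * y + dt e) = 1 - dt e by ring.
  exact: place_dist.
Qed.

End Schedule.

(** * The number of agents, and the optimal time *)

Lemma gap_ceil (R : realType) (r : R) (k : nat) : 0 < r -> r < 1 ->
  k%:Z = 6 + 2 * Num.ceil (r^-1 - 1) ->
  exists2 m, k = (2 * m + 6)%N & gap R m <= r.
Proof.
move=> r0 r1 kE.
have rV : 1 < r^-1 by rewrite invf_gt1.
have c0 : 0 <= Num.ceil (r^-1 - 1) by rewrite ceil_ge0; lra.
have := ceil_ge (r^-1 - 1).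
(* The ceiling is the number [m] of relays per leg, so [m + 1 >= 1 / r]. *)
move: kE c0; case: (Num.ceil (r^-1 - 1)) => // m kE _ hm.
exists m; first lia.
rewrite /gap invf_ple ?posrE ?ltr0n// -natr1.
by move: hm; rewrite -pmulrn; lra.
Qed.

Theorem theorem5p2 (R : realType) (r y : R) (k : nat) (A B C : 'rV[R]_2)
    (r_gt0 : 0 < r) (r_lt1 : r < 1)
    (y_def : y = Num.sqrt 3 / 6)
    (k_def : k%:Z = 6 + 2 * Num.ceil (r^-1 - 1))
    (AB1 : eucl_dist A B = 1) (BC1 : eucl_dist B C = 1)
    (CA1 : eucl_dist C A = 1) :
  (exists alg : algorithm k r (centroid A B C) (perimeter A B C),
      worst_case_time alg = (1 + 2 * y)%:E) /\
  (forall alg : algorithm k r (centroid A B C) (perimeter A B C),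
      ((1 + 2 * y)%:E <= worst_case_time alg)%E).
Proof.
have [m kE gr] := gap_ceil r_gt0 r_lt1 k_def; subst k.
have lower (alg : algorithm (2 * m + 6) r (centroid A B C) (perimeter A B C)) :
    ((1 + 2 * y)%:E <= worst_case_time alg)%E.
  have [hA hB] := centroid_vertex AB1 BC1 CA1 y_def.
  rewrite -{1}AB1; apply: worst_case_time_ge => //; first by rewrite addnS.
    by left; left; exists 0; rewrite /= ?lexx ?ler01 ?subr0 ?scale1r ?scale0r ?addr0.
  by left; left; exists 1; rewrite /= ?lexx ?ler01 ?subrr ?scale1r ?scale0r ?add0r.
split=> //; have [alg upper] := triangle_evacuation AB1 BC1 CA1 y_def gr.
by exists alg; apply/eqP; rewrite eq_le upper lower.
Qed.
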